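(* Let $y=y(x)$ satisfy $2\leqslant y\leqslant x$ and $y/\log x\to 0$ as $x\to\infty$. Then \[ |\mathcal{S}(x,y)\cdot\mathcal{S}(x,y)|=\Psi(x,y)^{1+o(1)}\qquad(x\to\infty), \] i.e., $\log|\mathcal{S}(x,y)\cdot\mathcal{S}(x,y)|/\log\Psi(x,y)\to 1$ as $x\to\infty$.
   Context: For real $x\geqslant y\geqslant 2$, $\mathcal{S}(x,y)=\{n\in\mathbb{Z}_{\geqslant 1} : n\leqslant x,\ P^+(n)\leqslant y\}$, where $P^+(n)$ denotes the largest prime factor of an integer $n\geqslant 2$ and $P^+(1)=1$, and $\Psi(x,y)=|\mathcal{S}(x,y)|$. For a set $\mathcal{A}$ of integers, $\mathcal{A}\cdot\mathcal{A}=\{aa' : a,a'\in\mathcal{A}\}$. $\log$ is the natural logarithm. *)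

(* Defs.v *)
From mathcomp Require Import all_boot all_order all_algebra.
From mathcomp Require Import finmap.
From mathcomp Require Import all_classical all_reals all_analysis.

Set Implicit Arguments.
Unset Strict Implicit.
Unset Printing Implicit Defensive.

Import Order.TTheory GRing.Theory Num.Theory.
Import numFieldNormedType.Exports.

Local Open Scope classical_set_scope.
Local Open Scope ring_scope.

(* [max_pdiv n] is the largest prime factor of n >= 2, and [max_pdiv 1 = 1]. *)
Definition smooth {R : realType} (x y : R) : set nat :=
  [set n | (1 <= n)%N /\ n%:R <= x /\ (max_pdiv n)%:R <= y].

Definition prodset (A B : set nat) : set nat :=
  [set (a * b)%N | a in A & b in B].

(* [fset_set] is [fset0] on infinite sets, so [ncard] is only meaningful on
   finite sets; see [finite_smooth] and [finite_prodset]. *)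
Definition ncard (A : set nat) : nat := #|` fset_set A|.

Definition Psi {R : realType} (x y : R) : nat := ncard (smooth x y).

Lemma finite_smooth (R : realType) (x y : R) : finite_set (smooth x y).
Proof.
apply: (@sub_finite_set _ _ `I_(Num.truncn x).+1); last exact: finite_II.
by move=> n [_ [nx _]] /=; rewrite -(ltr_nat R) (le_lt_trans nx) // truncnS_gt.
Qed.

Lemma finite_prodset (A B : set nat) :
  finite_set A -> finite_set B -> finite_set (prodset A B).
Proof. exact: finite_image2. Qed.

(* Main.v *)
(* Let k be the number of primes up to y.  Every n factors as a^2 s with s
   squarefree, and a product of two elements of S(x, y) is at most x^2, so its
   a lies in S(x, y) and its s is one of 2^k numbers:
   |S.S| <= 2^k Psi(x, y).  Conversely the product of the primes up to y is at
   most 8^y (Chebyshev), which is x^o(1), so for any fixed m all products of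
   primes up to y with exponents below 2^m are eventually at most x, whence
   Psi(x, y) >= (2^m)^k.  Together, |S.S|^m <= Psi(x, y)^(m + 1). *)

Require Import Defs.
From mathcomp Require Import all_boot all_order all_algebra.
From mathcomp Require Import finmap.
From mathcomp Require Import all_classical all_reals all_analysis.
From mathcomp Require Import zify lra.

Import Order.TTheory GRing.Theory Num.Theory.
Import numFieldNormedType.Exports.

Local Open Scope classical_set_scope.
Local Open Scope ring_scope.

(** * A Chebyshev-type bound for the product of the primes up to [n] *)

Lemma bin_le_exp2 n m : ('C(n, m) <= 2 ^ n)%N.
Proof.
elim: n m => [|n IHn] [|m] //; first by rewrite bin0 expn_gt0.
by rewrite binS expnS mul2n -addnn leq_add.
Qed.

Lemma prod_primes_dvdn (s : seq nat) n :
  uniq s -> all prime s -> all (dvdn^~ n) s -> (\prod_(p <- s) p %| n)%N.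
Proof.
elim: s => [|p s IHs] /=; first by rewrite big_nil dvd1n.
move=> /andP[ps us] /andP[pp prs] /andP[pn sn].
rewrite big_cons Gauss_dvd ?pn ?IHs // prime_coprime //.
apply: contra ps; rewrite Euclid_dvd_prod // big_has => /hasP[q qs].
by rewrite dvdn_prime2 // ?(allP prs) // => /eqP ->.
Qed.

(** Strong induction. An even [n > 2] adds no prime; for [n = 2m + 1] the primes up to [m + 1] fall
    to the induction hypothesis and the others divide a binomial coefficient. Base 8 rather than 4
    leaves room for the crude bound [2 ^ n] on that coefficient. *)
Lemma primorial_le n : (\prod_(0 <= p < n.+1 | prime p) p <= 8 ^ n)%N.
Proof.
elim/ltn_ind: n => n IHn.
have [nle2|n_gt2] := leqP n 2.
  by case: n nle2 {IHn} => [|[|[|//]]] _; rewrite unlock /=.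
have [odd_n|even_n] := boolP (odd n); last first.
  rewrite big_mkcond big_nat_recr //= -big_mkcond ifN; last first.
    by apply: contra even_n => /even_prime; case=> // n2; rewrite n2 in n_gt2.
  have -> : n = n.-1.+1 by lia.
  by rewrite muln1 (leq_trans (IHn _ _)) ?leq_pexp2l //; lia.
pose m := n./2; have nE : n = (m.*2).+1 by rewrite -(odd_double_half n) odd_n.
have m_gt0 : (0 < m)%N by lia.
rewrite (@big_cat_nat _ _ _ m.+2) //=; last by lia.
(* The primes in (m + 1, 2m + 1] divide the binomial coefficient C(2m + 1, m). *)
have dvdC : (\prod_(m.+2 <= p < n.+1 | prime p) p %| 'C(n, m))%N.
  rewrite -big_filter; apply: prod_primes_dvdn.
  - by rewrite filter_uniq ?iota_uniq.
  - exact: filter_all.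
  apply/allP => p; rewrite mem_filter mem_index_iota => /andP[pp /andP[mp pn]].
  (* This product is the factorial of [n], and [p <= n]. Neither factorial factor is divisible by
     [p], as [m] and [n - m = m + 1] are both below [p]. *)
  have : (p %| 'C(n, m) * (m`! * (n - m)`!))%N.
    by rewrite bin_fact ?dvdn_fact ?prime_gt0 //; lia.
  have fact_ndvd k : (k < p)%N -> ~~ (p %| k`!)%N.
    move=> kp; rewrite fact_prod Euclid_dvd_prod // big_has -all_predC.
    apply/allP => i; rewrite mem_index_iota => /andP[i0 ik] /=.
    by rewrite gtnNdvd //; lia.
  rewrite !Euclid_dvdM // => /or3P[//||]; apply: contraLR => _;
    by apply: fact_ndvd; lia.
have C_gt0 : (0 < 'C(n, m))%N by rewrite bin_gt0; lia.
apply: leq_trans (leq_mul (IHn _ _) (leq_trans (dvdn_leq C_gt0 dvdC) (bin_le_exp2 _ _))) _.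
  by lia.
(* In powers of 2: [3(m + 1) + (2m + 1) <= 3(2m + 1)], as [m >= 1]. *)
by rewrite -![(8 ^ _)%N](expnM 2 3) -expnD leq_pexp2l //; lia.
Qed.

(** * Numbers given by exponents over a finite family of primes *)

Section PrimeProducts.
Variables (T : finType) (pr : T -> nat).
Hypotheses (pr_inj : injective pr) (pr_prime : forall t, prime (pr t)).

Definition prime_prod (e : T -> nat) : nat := (\prod_t pr t ^ e t)%N.

Lemma prime_prod_gt0 e : (0 < prime_prod e)%N.
Proof. by rewrite prodn_gt0 // => t; rewrite expn_gt0 prime_gt0. Qed.

(** Summing over the fibre of [p] gives one formula for every [p], including those that are not
    values of [pr], where the sum is empty. *)
Lemma logn_prime_prod p e :
  logn p (prime_prod e) = (\sum_(t | pr t == p) e t)%N.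
Proof.
rewrite big_mkcond /prime_prod.
suff [] : logn p (\prod_t pr t ^ e t) = (\sum_t if pr t == p then e t else 0)%N
  /\ (0 < \prod_t pr t ^ e t)%N by [].
apply: (big_rec2 (fun a b => logn p a = b /\ 0 < a)%N); first by rewrite logn1.
move=> t b a _ [<- a0]; have pt0 := prime_gt0 (pr_prime t).
rewrite lognM ?expn_gt0 ?pt0 // muln_gt0 expn_gt0 pt0 a0; split => //.
congr (_ + _)%N.
by rewrite lognX (logn_prime p (pr_prime t)) eq_sym; case: eqP; rewrite ?muln1 ?muln0.
Qed.

Lemma logn_prime_prod_id t e : logn (pr t) (prime_prod e) = e t.
Proof.
rewrite logn_prime_prod (big_pred1 t) // => u.
by rewrite (inj_eq pr_inj).
Qed.

Lemma prime_prodD e f :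
  (prime_prod (fun t => e t + f t) = prime_prod e * prime_prod f)%N.
Proof. by rewrite -big_split; apply: eq_bigr => t _; rewrite expnD. Qed.

Lemma prime_prod_logn n : (0 < n)%N ->
  (forall p, prime p -> (p %| n)%N -> exists t, pr t = p) ->
  prime_prod (fun t => logn (pr t) n) = n.
Proof.
move=> n0 prn; apply: eqn_from_log => // [|p]; first exact: prime_prod_gt0.
have [pn|pn] := boolP (p \in primes n); last first.
  rewrite logn_prime_prod big1 => [|t /eqP -> //].
    by apply/esym/eqP; rewrite -leqn0 leqNgt logn_gt0.
  by apply/eqP; rewrite -leqn0 leqNgt logn_gt0.
move: pn; rewrite mem_primes => /and3P[pp _ pn].
by have [t <-] := prn p pp pn; rewrite logn_prime_prod_id.
Qed.

End PrimeProducts.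

(** * Comparing cardinalities of finite sets *)

Lemma card_le_ncard (T : finType) (f : T -> nat) (A : set nat) :
  injective f -> finite_set A -> (forall t, A (f t)) -> (#|T| <= ncard A)%N.
Proof.
move=> f_inj finA fA; rewrite cardE -(size_map f).
apply: uniq_leq_size; first by rewrite map_inj_uniq ?enum_uniq.
by move=> _ /mapP[t _ ->]; rewrite in_fset_set // inE.
Qed.

Lemma ncard_le (A B : set nat) : finite_set B -> A `<=` B ->
  (ncard A <= ncard B)%N.
Proof.
move=> finB AB; rewrite /ncard fsubset_leq_card //.
by rewrite -fset_set_sub //; exact: sub_finite_set AB finB.
Qed.

(** The list of all values [g a t], repetitions allowed, has [ncard A * #|T|] entries and contains
    [C]. *)
Lemma ncard_le_mul (T : finType) (g : nat -> T -> nat) (A C : set nat) :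
  finite_set A -> finite_set C ->
  (forall c, C c -> exists a t, A a /\ c = g a t) ->
  (ncard C <= ncard A * #|T|)%N.
Proof.
move=> finA finC gC; rewrite cardE -(size_allpairs g).
apply: uniq_leq_size; first exact: fset_uniq.
move=> c; rewrite in_fset_set // inE => /gC[a [t [Aa ->]]].
by apply: allpairs_f; rewrite ?mem_enum // in_fset_set ?inE.
Qed.

(** * Smooth numbers and their exponent vectors *)

Lemma smoothP (R : realType) (x y : R) n : 1 <= y ->
  smooth x y n <->
  [/\ (0 < n)%N, n%:R <= x &
      forall p, prime p -> (p %| n)%N -> (p <= Num.truncn y)%N].
Proof.
move=> y1; have y0 : 0 <= y by lra.
split=> [[n0 [nx ny]]|[n0 nx ny]].
  split=> // p pp pn; rewrite truncn_ge_nat // (le_trans _ ny) // ler_nat.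
  by rewrite max_pdiv_max // mem_primes pp n0.
split=> //; split=> //; rewrite -truncn_ge_nat //.
have [n1|] := ltnP 1 n; first by rewrite ny ?max_pdiv_prime ?max_pdiv_dvd.
(* Only [n = 1] remains, where [max_pdiv 1 = 1] and [1 <= y] applies. *)
by case: n n0 {nx ny} => [|[|]] // _ _; rewrite truncn_ge_nat.
Qed.

Section SmoothCounting.
Variables (R : realType) (x y : R).
Hypothesis y2 : 2 <= y.

(** A finite type, so that exponent vectors are finite functions that can be counted. *)
Definition small_prime : finType := {p : 'I_(Num.truncn y).+1 | prime p}.
Definition small_prime_val (p : small_prime) : nat := val p.

Let y1 : 1 <= y. Proof. by apply: le_trans y2; rewrite ler1n. Qed.

Lemma small_prime_val_inj : injective small_prime_val.
Proof. by move=> p q /val_inj/val_inj. Qed.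

Lemma small_prime_valP p : prime (small_prime_val p).
Proof. exact: valP p. Qed.

Lemma small_prime_ex p : prime p -> (p <= Num.truncn y)%N ->
  exists t, small_prime_val t = p.
Proof. by rewrite -ltnS => pp py; exists (exist _ (Ordinal py) pp). Qed.

Lemma small_prime_gt0 : (0 < #|small_prime|)%N.
Proof.
have two_le : (2 <= Num.truncn y)%N by rewrite truncn_ge_nat // (le_trans _ y2) ?ler0n.
by have [t _] := small_prime_ex 2 isT two_le; apply/card_gt0P; exists t.
Qed.

Local Notation pprod := (prime_prod small_prime small_prime_val).

Lemma dvdn_pprod p e : prime p -> (p %| pprod e)%N -> (p <= Num.truncn y)%N.
Proof.
move=> pp; rewrite /prime_prod Euclid_dvd_prod // big_orE => /existsP[t /=].
rewrite Euclid_dvdX // => /andP[+ _].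
rewrite dvdn_prime2 ?small_prime_valP // => /eqP ->.
by rewrite -ltnS; apply: ltn_ord.
Qed.

Lemma pprod1_le : (pprod (fun=> 1) <= 8 ^ Num.truncn y)%N.
Proof.
apply: leq_trans (primorial_le _).
rewrite big_mkord (big_sub (fun p : 'I__ => prime p) val).
by apply: eq_leq; apply: eq_bigr => t _; rewrite expn1.
Qed.

(** Here [k] bounds the exponents. By unique factorization, exponent vectors with entries from 0 to
    [k] give distinct numbers, each at most the [k]-th power of the primorial. *)
Lemma exp_card_le_Psi k : ((8 ^ Num.truncn y) ^ k)%:R <= x ->
  (k.+1 ^ #|small_prime| <= Psi x y)%N.
Proof.
move=> kx; rewrite /Psi -[k.+1]card_ord -card_ffun.
apply: (card_le_ncard _ (fun e : {ffun small_prime -> 'I_k.+1} =>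
  pprod (fun t => e t))).
- move=> e f ef; apply/ffunP => t; apply: val_inj.
  have := congr1 (logn (small_prime_val t)) ef.
  by rewrite !(logn_prime_prod_id _ _ small_prime_val_inj small_prime_valP).
- exact: finite_smooth.
move=> e; apply/smoothP => //; split.
- exact/prime_prod_gt0/small_prime_valP.
- apply: le_trans kx; rewrite ler_nat.
  apply: (@leq_trans (pprod (fun=> 1) ^ k)%N).
    rewrite /prime_prod (big_morph (expn^~ k) (fun a b => expnMn a b k) (exp1n k)); apply: leq_prod => t _.
    by rewrite expn1 leq_pexp2l ?prime_gt0 ?small_prime_valP -1?ltnS.
  by case: (k) => // j; rewrite leq_exp2r // pprod1_le.
- by move=> p; apply: dvdn_pprod.
Qed.

Lemma ncard_prodset_le :
  (ncard (prodset (smooth x y) (smooth x y)) <= Psi x y * 2 ^ #|small_prime|)%N.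
Proof.
rewrite /Psi -card_bool -card_ffun.
apply: (@ncard_le_mul _ (fun a (b : {ffun small_prime -> bool}) =>
  a * a * pprod (fun t => b t))%N).
- exact: finite_smooth.
- by apply: finite_prodset; apply: finite_smooth.
move=> _ [a /(smoothP _ _ _ _ y1)[a0 ax ay] [b /(smoothP _ _ _ _ y1)[b0 bx by_] <-]].
have ab0 : (0 < a * b)%N by rewrite muln_gt0 a0.
(* Halving each exponent of [a * b] gives the square [h * h]; the parities give the squarefree
   part. *)
pose e t := logn (small_prime_val t) (a * b).
pose h := pprod (fun t => (e t)./2).
have ab_prime p : prime p -> (p %| a * b)%N -> (p <= Num.truncn y)%N.
  by move=> pp; rewrite Euclid_dvdM // => /orP[/ay|/by_]; apply.
have abE : (a * b = h * h * pprod (fun t => odd (e t)))%N.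
  rewrite -!prime_prodD -[LHS](prime_prod_logn _ _ small_prime_val_inj
    small_prime_valP) //.
    by apply: eq_bigr => t _; rewrite addnn addnC odd_double_half.
  by move=> p pp /ab_prime py; apply: small_prime_ex => //; apply: py.
exists h, [ffun t => odd (e t)]; split; last first.
  by rewrite abE; congr (_ * _)%N; apply: eq_bigr => t _; rewrite ffunE.
have h0 : (0 < h)%N by apply/prime_prod_gt0/small_prime_valP.
apply/smoothP => //; split=> //.
  have s0 : (0 < pprod (fun t => odd (e t)))%N.
    by apply/prime_prod_gt0/small_prime_valP.
  (* From [h * h <= a * b], [h] is at most the larger of [a] and [b], hence at most [x]. *)
  have hab : (h * h <= a * b)%N by rewrite abE leq_pmulr.
  have [ha|ah] := leqP h a; first by rewrite (le_trans _ ax) ?ler_nat.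
  by rewrite (le_trans _ bx) // ler_nat; nia.
by move=> p; apply: dvdn_pprod.
Qed.

End SmoothCounting.

(** * Combining the bounds and passing to the limit *)

Lemma ncard_prodset_exp_le (R : realType) (x y : R) m : 2 <= y ->
  ((8 ^ Num.truncn y) ^ (2 ^ m.+1))%:R <= x ->
  [/\ (1 < Psi x y)%N,
      (Psi x y <= ncard (prodset (smooth x y) (smooth x y)))%N &
      (ncard (prodset (smooth x y) (smooth x y)) ^ m.+1 <= Psi x y ^ m.+2)%N].
Proof.
move=> y2 mx.
set P := Psi x y; set k := #|small_prime R y|.
have kP : ((2 ^ m.+1) ^ k <= P)%N.
  apply: leq_trans (exp_card_le_Psi _ _ _ y2 _ mx).
  by rewrite leq_exp2r ?small_prime_gt0.
split.
- by apply: leq_trans kP; rewrite -expnM -{1}(expn0 2) ltn_exp2l // muln_gt0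
    small_prime_gt0.
- apply: ncard_le; first by apply: finite_prodset; apply: finite_smooth.
  move=> n nS; exists n => //; exists 1%N; last exact: muln1.
  split=> //; split; last by rewrite (le_trans _ y2) // ler1n.
  by rewrite (le_trans _ mx) // ler_nat !expn_gt0.
(* The power [m.+1] turns the factor [2 ^ k] into [(2 ^ m.+1) ^ k], which [kP] bounds by one more
   factor [P]. *)
apply: leq_trans (_ : (P * 2 ^ k) ^ m.+1 <= _)%N.
  by rewrite leq_exp2r // ncard_prodset_le.
by rewrite expnMn (expnSr P m.+1) leq_mul2l -expnM mulnC expnM kP orbT.
Qed.

Theorem theorem4 (R : realType) (y : R -> R)
    (hy : \forall x \near +oo, 2 <= y x <= x)
    (hylog : y x / ln x @[x --> +oo] --> (0 : R)) :
  ln (ncard (prodset (smooth x (y x)) (smooth x (y x))))%:R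
    / ln (Psi x (y x))%:R @[x --> +oo] --> (1 : R).
Proof.
apply/cvgrPdist_le => eps eps0.
(* The ratio of logarithms will be at most [(m + 2) / (m + 1)], so [1 / (m + 1) <= eps] suffices. *)
pose m := Num.truncn eps^-1.
have m_eps : 1 <= m.+1%:R * eps.
  by rewrite -ler_pdivrMr // mul1r ltW // truncnS_gt.
(* Chosen so that [y x * c <= ln x] yields the size condition [mx] after taking logarithms. *)
pose c : R := (2 ^ m.+1)%:R * ln 8.
have c0 : 0 < c by rewrite mulr_gt0 ?ltr0n ?expn_gt0 // ln_gt0 // ltr1n.
move/cvgrPdist_le : hylog => /(_ c^-1).
rewrite invr_gt0 => /(_ c0) hylog.
near=> x.
have /andP[y2 yx] : 2 <= y x <= x by near: x.
have x1 : 1 < x by rewrite (lt_le_trans _ (le_trans y2 yx)) // ltr1n.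
have lnx0 : 0 < ln x by rewrite ln_gt0.
have y0 : 0 <= y x by rewrite (le_trans _ y2).
have ylog : y x * c <= ln x.
  have : `|0 - y x / ln x| <= c^-1 by near: x.
  rewrite sub0r normrN ger0_norm ?(divr_ge0 _ (ltW lnx0)) // ler_pdivrMr //.
  by rewrite mulrC ler_pdivlMr.
have mx : ((8 ^ Num.truncn (y x)) ^ (2 ^ m.+1))%:R <= x.
  have pos8 : 0 < ((8 ^ Num.truncn (y x)) ^ (2 ^ m.+1))%:R :> R.
    by rewrite ltr0n !expn_gt0.
  rewrite -ler_ln ?posrE ?(lt_trans _ x1) // -expnM natrX lnXn ?ltr0n //.
  apply: le_trans ylog; rewrite -(mulr_natl _ (_ * _)%N) natrM /c mulrA ler_wpM2r //.
    by rewrite ln_ge0 // ler1n.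
  by rewrite ler_wpM2r ?ler0n // truncn_le.
have [P1 PS SP] := ncard_prodset_exp_le _ _ _ m y2 mx.
set S := ncard _ in PS SP *; set P := Psi _ _ in P1 PS SP *.
have P0 : (0 < P)%N := ltnW P1.
have S0 : (0 < S)%N := leq_trans P0 PS.
have lnP0 : 0 < ln P%:R :> R by rewrite ln_gt0 // ltr1n.
have lnPS : ln P%:R <= ln S%:R :> R by rewrite ler_ln ?posrE ?ltr0n ?ler_nat.
have lnSP : m.+1%:R * ln S%:R <= m.+2%:R * ln P%:R :> R.
  rewrite !mulr_natl -!lnXn ?ltr0n // -!natrX.
  by rewrite ler_ln ?posrE ?ltr0n ?expn_gt0 ?S0 ?P0 // ler_nat.
(* The ratio is at least 1 by [lnPS], so only the upper bound remains; it reduces to [m_eps]. *)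
rewrite distrC ger0_norm; last by rewrite subr_ge0 ler_pdivlMr // mul1r.
rewrite lerBlDr ler_pdivrMr // -(@ler_pM2l _ m.+1%:R) ?ltr0n //.
apply: le_trans lnSP _; rewrite mulrA ler_wpM2r ?(ltW lnP0) //.
by rewrite mulrDr mulr1 -(natr1 m.+1) addrC lerD2r.
Unshelve. all: by end_near.
Qed.
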